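(* Let $\ell$ be an odd prime and fix $\delta\in(0,1)$. For a real number $x>0$, let $\mathcal{A}_{\le x}(\ell)$ be the set of pairs $(t,\alpha)$ where $t\ge2$ is an integer with $t\le x^\delta$ and $\alpha=(\alpha_1,\dots,\alpha_t)\in\mathbb{Z}^t$ is such that $\max\{|\alpha_1|,\dots,|\alpha_t|\}\le x$ and $\ell\nmid\alpha_i$ for some $1\le i\le t$. Let $\mathcal{T}_{\le x}(0,1,\ell)$ be the subset of those $(t,\alpha)\in\mathcal{A}_{\le x}(\ell)$ for which $\mu_\ell(X_t,\alpha)=0$ and $\lambda_\ell(X_t,\alpha)=1$. Then $$\lim_{x\to\infty}\frac{\#\mathcal{T}_{\le x}(0,1,\ell)}{\#\mathcal{A}_{\le x}(\ell)}=1-\ell^{-1}.$$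
   Context: For $b\in\mathbb{Z}_\ell$ put $\binom{b}{n}=\frac{b(b-1)\cdots(b-n+1)}{n!}\in\mathbb{Z}_\ell$ and $(1+T)^b=\sum_{n\ge0}\binom{b}{n}T^n\in\mathbb{Z}_\ell[[T]]$. The bouquet $X_t$ is the multigraph with one vertex and $t$ undirected loops; a vector $\alpha=(\alpha_1,\dots,\alpha_t)\in\mathbb{Z}_\ell^t$ assigns the voltage $\alpha_j$ to the $j$-th loop. It is admissible if $\alpha\in\mathbb{Z}_\ell^t\setminus(\ell\mathbb{Z}_\ell)^t$. The characteristic series is $$f(T)=f_{X_t,\alpha}(T)=\sum_{j=1}^t\big(2-(1+T)^{\alpha_j}-(1+T)^{-\alpha_j}\big)\in\mathbb{Z}_\ell[[T]].$$ For admissible $\alpha$ it is nonzero, and it has zero constant term. By Weierstrass preparation write $f(T)=\ell^{\mu}g(T)u(T)$ with $\mu\in\mathbb{Z}_{\ge0}$, $g$ a distinguished polynomial (monic, all non-leading coefficients divisible by $\ell$) and $u\in\mathbb{Z}_\ell[[T]]^\times$. Then $\mu_\ell(X_t,\alpha):=\mu$ and $\lambda_\ell(X_t,\alpha):=\deg g-1$ (note the shift by $-1$). Integral vectors are viewed in $\mathbb{Z}_\ell^t$ via $\mathbb{Z}\subset\mathbb{Z}_\ell$. *)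

(* Defs.v *)
From HB Require Import structures.
From mathcomp Require Import all_boot all_order all_algebra.
From mathcomp Require Import finmap.
From mathcomp Require Import boolp classical_sets cardinality reals.
From mathcomp Require Import topology normedtype exp.

Set Implicit Arguments.
Unset Strict Implicit.
Unset Printing Implicit Defensive.

Import Order.TTheory GRing.Theory Num.Theory.

Local Open Scope ring_scope.

(* The ring of p-adic integers, as the inverse limit of the rings Z / p^n: the
   n-th component is the representative in [0, p^n) of the residue mod p^n. The
   condition on consecutive components also forces this normalization. *)
Record padic_int (p : nat) (p_pr : prime p) := PadicInt {
  padic_res :> nat -> int;
  padic_resS : forall n, padic_res n = (padic_res n.+1 %% (p ^ n)%N%:Z)%Z
}.

Section PadicRing.
Variables (p : nat) (p_pr : prime p).
Local Notation Zp := (padic_int p_pr).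
Local Notation "m ~[ n ] m'" := (m = m' %[mod (p ^ n)%N%:Z])%Z
  (at level 70, n at level 0, m' at next level).

HB.instance Definition _ := gen_eqMixin Zp.
HB.instance Definition _ := gen_choiceMixin Zp.

Lemma modz_expS (m : int) n :
  ((m %% (p ^ n.+1)%N%:Z)%Z %% (p ^ n)%N%:Z)%Z = (m %% (p ^ n)%N%:Z)%Z.
Proof.
rewrite {2}(divz_eq m (p ^ n.+1)%N%:Z) expnS PoszM mulrA addrC.
by rewrite [in RHS]addrC modzMDl.
Qed.

Lemma padic_mod (x : Zp) n : (x n %% (p ^ n)%N%:Z)%Z = x n.
Proof. by rewrite [x n]padic_resS modz_mod. Qed.

Lemma padic_modS (x : Zp) n : x n.+1 ~[n] x n.
Proof. by rewrite [x n]padic_resS modz_mod. Qed.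

Lemma padic_eqP (x y : Zp) : (forall n, x n ~[n] y n) -> x = y.
Proof.
move=> xy; have {}xy : padic_res x = padic_res y.
  by apply/funext => n; rewrite -padic_mod xy padic_mod.
case: x y xy => [x hx] [y hy] /= xy; case: _ / xy hy => hy.
by congr PadicInt; apply: Prop_irrelevance.
Qed.

Lemma padic_of_subproof (u : nat -> int) (hu : forall n, u n.+1 ~[n] u n) n :
  (u n %% (p ^ n)%N%:Z)%Z
    = ((u n.+1 %% (p ^ n.+1)%N%:Z)%Z %% (p ^ n)%N%:Z)%Z.
Proof. by rewrite modz_expS hu. Qed.

Definition padic_of (u : nat -> int) (hu : forall n, u n.+1 ~[n] u n) : Zp :=
  PadicInt p_pr (padic_of_subproof hu).

Lemma padic_ofE u hu n : @padic_of u hu n ~[n] u n.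
Proof. exact: modz_mod. Qed.

Lemma modzD_congr d (a b a' b' : int) : (a = a' %[mod d])%Z ->
  (b = b' %[mod d])%Z -> (a + b = a' + b' %[mod d])%Z.
Proof. by move=> ha hb; rewrite -modzDm ha hb modzDm. Qed.

Lemma modzN_congr d (a a' : int) : (a = a' %[mod d])%Z ->
  (- a = - a' %[mod d])%Z.
Proof. by move=> ha; rewrite -modzNm ha modzNm. Qed.

Lemma modzM_congr d (a b a' b' : int) : (a = a' %[mod d])%Z ->
  (b = b' %[mod d])%Z -> (a * b = a' * b' %[mod d])%Z.
Proof. by move=> ha hb; rewrite -modzMm ha hb modzMm. Qed.

Definition padic_zero : Zp := @padic_of (fun=> 0) (fun=> erefl).
Definition padic_one : Zp := @padic_of (fun=> 1) (fun=> erefl).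
Definition padic_opp (x : Zp) : Zp :=
  @padic_of (fun n => - x n) (fun n => modzN_congr (padic_modS x n)).
Definition padic_add (x y : Zp) : Zp :=
  @padic_of (fun n => x n + y n)
    (fun n => modzD_congr (padic_modS x n) (padic_modS y n)).
Definition padic_mul (x y : Zp) : Zp :=
  @padic_of (fun n => x n * y n)
    (fun n => modzM_congr (padic_modS x n) (padic_modS y n)).

Lemma padic_addA : associative padic_add.
Proof. by move=> x y z; apply: padic_eqP => n; rewrite !padic_ofE modzDml modzDmr addrA. Qed.
Lemma padic_addC : commutative padic_add.
Proof. by move=> x y; apply: padic_eqP => n; rewrite !padic_ofE addrC. Qed.
Lemma padic_add0 : left_id padic_zero padic_add.
Proof. by move=> x; apply: padic_eqP => n; rewrite padic_ofE modzDml add0r. Qed.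
Lemma padic_addN : left_inverse padic_zero padic_opp padic_add.
Proof. by move=> x; apply: padic_eqP => n; rewrite !padic_ofE modzDml addNr. Qed.

HB.instance Definition _ :=
  GRing.isZmodule.Build Zp padic_addA padic_addC padic_add0 padic_addN.

Lemma padic_mulA : associative padic_mul.
Proof. by move=> x y z; apply: padic_eqP => n; rewrite !padic_ofE modzMml modzMmr mulrA. Qed.
Lemma padic_mulC : commutative padic_mul.
Proof. by move=> x y; apply: padic_eqP => n; rewrite !padic_ofE mulrC. Qed.
Lemma padic_mul1 : left_id padic_one padic_mul.
Proof. by move=> x; apply: padic_eqP => n; rewrite padic_ofE modzMml mul1r. Qed.
Lemma padic_mulD : left_distributive padic_mul padic_add.
Proof.
move=> x y z; apply: padic_eqP => n.
by rewrite !padic_ofE modzMml -modzDm !modz_mod modzDm mulrDl.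
Qed.
Lemma padic_1neq0 : padic_one != 0.
Proof.
apply/eqP => /(congr1 (fun x : Zp => x 1%N)) /=.
by rewrite mod0z modz_small // expn1 /= ltz_nat prime_gt1.
Qed.

HB.instance Definition _ := GRing.Zmodule_isComNzRing.Build Zp
  padic_mulA padic_mulC padic_mul1 padic_mulD padic_1neq0.

Lemma padic_resD (x y : Zp) n : (x + y) n ~[n] x n + y n.
Proof. exact: padic_ofE. Qed.
Lemma padic_resN (x : Zp) n : (- x) n ~[n] - x n.
Proof. exact: padic_ofE. Qed.
Lemma padic_resM (x y : Zp) n : (x * y) n ~[n] x n * y n.
Proof. exact: padic_ofE. Qed.

Lemma padic_res_nat (m : nat) n : (m%:R : Zp) n ~[n] m%:Z.
Proof.
elim: m => [|m IHm]; first exact: padic_ofE.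
rewrite mulrS padic_resD intS; apply: modzD_congr => //; exact: padic_ofE.
Qed.

Lemma padic_res_int (m : int) n : (m%:~R : Zp) n ~[n] m.
Proof.
case: m => m; first exact: padic_res_nat.
by rewrite NegzE mulrNz padic_resN; apply/modzN_congr/padic_res_nat.
Qed.

Lemma padic_res_le (x : Zp) n k : x (n + k)%N ~[n] x n.
Proof.
elim: k => [|k IHk]; first by rewrite addn0.
rewrite addnS -IHk; apply/eqP; rewrite eqz_mod_dvd.
apply: (@dvdz_trans (p ^ (n + k))%N%:Z).
  by rewrite expnD PoszM dvdz_mulr.
by rewrite -eqz_mod_dvd; apply/eqP/padic_modS.
Qed.

Lemma dvdz_exp_logn (m k : nat) (d : int) : (0 < m)%N ->
  ((p ^ (k + logn p m))%N %| m%:Z * d)%Z -> ((p ^ k)%N %| d)%Z.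
Proof.
move=> m_gt0; rewrite !dvdzE abszM !absz_nat.
have [->|] := eqVneq (absz d) 0%N; first by rewrite dvdn0.
rewrite -lt0n => d_gt0.
by rewrite !pfactor_dvdn ?muln_gt0 ?m_gt0 // lognM // addnC leq_add2l.
Qed.

Lemma padic_torsion_free (m : nat) : (0 < m)%N ->
  injective (fun x : Zp => m%:R * x).
Proof.
move=> m_gt0 x y /= xy; apply: padic_eqP => n.
pose N := (n + logn p m)%N.
rewrite -(padic_res_le x n (logn p m)) -(padic_res_le y n (logn p m)) -/N.
apply/eqP; rewrite eqz_mod_dvd; apply: (dvdz_exp_logn m_gt0).
rewrite mulrBr -eqz_mod_dvd -/N.
rewrite -(modzM_congr (padic_res_nat m N) (erefl (x N %% _)%Z)).
rewrite -(modzM_congr (padic_res_nat m N) (erefl (y N %% _)%Z)).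
by rewrite -!padic_resM xy.
Qed.

Lemma padic_divisible (m : nat) (x : Zp) (z : nat -> int) : (0 < m)%N ->
  (forall n, x n ~[n] m%:Z * z n) -> exists y : Zp, m%:R * y = x.
Proof.
move=> m_gt0 hz; pose v := logn p m.
have hu n : z (n.+1 + v)%N ~[n] z (n + v)%N.
  apply/eqP; rewrite eqz_mod_dvd; apply: (dvdz_exp_logn m_gt0).
  rewrite mulrBr -eqz_mod_dvd -/v -hz -padic_modS -addSn.
  apply/eqP; rewrite -modz_expS -addSn -hz modz_expS.
  by [].
exists (padic_of hu); apply: padic_eqP => n.
rewrite padic_resM (modzM_congr (padic_res_nat m n) (padic_ofE hu n)).
rewrite -(padic_res_le x n v).
have /eqP := hz (n + v)%N; rewrite eqz_mod_dvd => hd.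
apply/esym/eqP; rewrite eqz_mod_dvd; apply: dvdz_trans hd.
by rewrite expnD PoszM dvdz_mulr.
Qed.

End PadicRing.

(* binom(b, n) = b (b - 1) ... (b - n + 1) / n!; the quotient exists and is
   unique in Z_p by the two lemmas below. *)
Definition padic_binom (p : nat) (p_pr : prime p) (b : padic_int p_pr) (n : nat)
    : padic_int p_pr :=
  xget 0 [set c | n`!%:R * c = \prod_(i < n) (b - i%:R)]%classic.

Lemma ffact_prod_int (m n : nat) : (m ^_ n)%N%:Z = \prod_(i < n) (m%:Z - i%:Z).
Proof.
elim: n => [|n IHn]; first by rewrite big_ord0.
rewrite ffactnSr PoszM IHn big_ord_recr /=.
have [nm|mn] := leqP n m; first by rewrite subzn.
by rewrite -IHn ffact_small // !mul0r.
Qed.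

Lemma padic_binomP (p : nat) (p_pr : prime p) (b : padic_int p_pr) (n : nat) :
  n`!%:R * padic_binom b n = \prod_(i < n) (b - i%:R).
Proof.
suff [c hc] : exists c, n`!%:R * c = \prod_(i < n) (b - i%:R).
  exact: (xgetI 0 (P := [set c | n`!%:R * c = _]%classic) hc).
apply: (@padic_divisible _ _ _ _ (fun k => 'C(`|b k|, n)%N%:Z)).
  exact: fact_gt0.
move=> k; have bk_ge0 : 0 <= b k.
  by rewrite -padic_mod modz_ge0 // gt_eqF // ltz_nat expn_gt0 prime_gt0.
rewrite -PoszM mulnC bin_ffact ffact_prod_int gez0_abs //.
elim: n => [|n IHn]; first by rewrite !big_ord0; exact: padic_ofE.
rewrite !big_ord_recr padic_resM; apply: modzM_congr; first exact: IHn.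
rewrite padic_resD; apply: modzD_congr; first by [].
by rewrite padic_resN; apply/modzN_congr/padic_res_nat.
Qed.

Lemma padic_binom_uniq (p : nat) (p_pr : prime p) (b c : padic_int p_pr)
    (n : nat) :
  n`!%:R * c = \prod_(i < n) (b - i%:R) -> c = padic_binom b n.
Proof.
by rewrite -padic_binomP; apply: padic_torsion_free; exact: fact_gt0.
Qed.

(* Formal power series, given by their coefficients. *)
Record pseries (R : comNzRingType) := PSeries { pscoef :> nat -> R }.

Section PowerSeriesRing.
Variable R : comNzRingType.
Local Notation S := (pseries R).

HB.instance Definition _ := gen_eqMixin S.
HB.instance Definition _ := gen_choiceMixin S.

Lemma pseriesP (a b : S) : (forall n, a n = b n) -> a = b.
Proof. by case: a b => [a] [b] ab; congr PSeries; apply/funext. Qed.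

Definition pseries_zero : S := PSeries (fun=> 0).
Definition pseries_one : S := PSeries (fun n => (n == 0)%:R).
Definition pseries_opp (a : S) : S := PSeries (fun n => - a n).
Definition pseries_add (a b : S) : S := PSeries (fun n => a n + b n).
Definition pseries_mul (a b : S) : S :=
  PSeries (fun n => \sum_(i < n.+1) a i * b (n - i)%N).

Lemma pseries_addA : associative pseries_add.
Proof. by move=> a b c; apply: pseriesP => n /=; rewrite addrA. Qed.
Lemma pseries_addC : commutative pseries_add.
Proof. by move=> a b; apply: pseriesP => n /=; rewrite addrC. Qed.
Lemma pseries_add0 : left_id pseries_zero pseries_add.
Proof. by move=> a; apply: pseriesP => n /=; rewrite add0r. Qed.
Lemma pseries_addN : left_inverse pseries_zero pseries_opp pseries_add.
Proof. by move=> a; apply: pseriesP => n /=; rewrite addNr. Qed.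

HB.instance Definition _ :=
  GRing.isZmodule.Build S pseries_addA pseries_addC pseries_add0 pseries_addN.

Definition pseries_trunc (m : nat) (a : S) : {poly R} := \poly_(i < m) a i.

Lemma pseries_mul_trunc (m : nat) (a b : S) n : (n < m)%N ->
  pseries_mul a b n = (pseries_trunc m a * pseries_trunc m b)`_n.
Proof.
move=> nm; rewrite coefM; apply: eq_bigr => i _ /=.
by rewrite !coef_poly !(leq_ltn_trans _ nm) ?leq_subr // -ltnS.
Qed.

Lemma pseries_mulA : associative pseries_mul.
Proof.
move=> a b c; apply: pseriesP => n.
have coefE (d e : S) (i : nat) : (i < n.+1)%N -> (pseries_trunc n.+1 (pseries_mul d e))`_i
    = (pseries_trunc n.+1 d * pseries_trunc n.+1 e)`_i.
  by move=> hi; rewrite coef_poly hi (pseries_mul_trunc _ _ hi).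
rewrite !(@pseries_mul_trunc n.+1) // coefM.
under eq_bigr => i _ do rewrite coefE ?ltnS ?leq_subr //.
rewrite -coefM mulrA !coefM; apply: eq_bigr => i _.
by rewrite coefE.
Qed.
Lemma pseries_mulC : commutative pseries_mul.
Proof.
move=> a b; apply: pseriesP => n.
by rewrite !(@pseries_mul_trunc n.+1) // mulrC.
Qed.
Lemma pseries_mul1 : left_id pseries_one pseries_mul.
Proof.
move=> a; apply: pseriesP => n /=.
by rewrite big_ord_recl /= mul1r subn0 big1 ?addr0 // => i _; rewrite mul0r.
Qed.
Lemma pseries_mulD : left_distributive pseries_mul pseries_add.
Proof.
move=> a b c; apply: pseriesP => n /=; rewrite -big_split /=.
by apply: eq_bigr => i _; rewrite mulrDl.
Qed.
Lemma pseries_1neq0 : pseries_one != 0.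
Proof.
apply/eqP => /(congr1 (fun a : S => a 0%N)) /= /eqP.
by rewrite oner_eq0.
Qed.

HB.instance Definition _ := GRing.Zmodule_isComNzRing.Build S
  pseries_mulA pseries_mulC pseries_mul1 pseries_mulD pseries_1neq0.

Definition pseries_of_poly (g : {poly R}) : S := PSeries (fun n => g`_n).

Definition pseries_unit (u : S) : Prop := exists v : S, u * v = 1.

End PowerSeriesRing.

Section IwasawaInvariants.
Variables (p : nat) (p_pr : prime p).
Local Notation Zp := (padic_int p_pr).

(* (1 + T)^b *)
Definition pow1T (b : Zp) : pseries Zp := PSeries (padic_binom b).

Definition charseries (t : nat) (alpha : 'I_t -> Zp) : pseries Zp :=
  \sum_(j < t) (2%:R - pow1T (alpha j) - pow1T (- alpha j)).

Definition distinguished (g : {poly Zp}) : Prop :=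
  g \is monic /\
  forall i, (i < (size g).-1)%N -> exists c : Zp, g`_i = p%:R * c.

Definition weierstrass (f : pseries Zp) (w : nat * {poly Zp} * pseries Zp) :
    Prop :=
  let: (mu, g, u) := w in
  [/\ distinguished g, pseries_unit u
    & f = p%:R ^+ mu * pseries_of_poly g * u].

(* For nonzero f such a triple exists and is unique; the default value is only
   used for f = 0. *)
Definition weierstrass_fact (f : pseries Zp) : nat * {poly Zp} * pseries Zp :=
  xget (0%N, 0, 0) [set w | weierstrass f w]%classic.

Definition mu_inv (t : nat) (alpha : 'I_t -> Zp) : nat :=
  (weierstrass_fact (charseries alpha)).1.1.

(* (size g).-1 is the degree of g; the invariant is deg g - 1, taken in int. *)
Definition lambda_inv (t : nat) (alpha : 'I_t -> Zp) : int :=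
  (size (weierstrass_fact (charseries alpha)).1.2).-1%:Z - 1.

End IwasawaInvariants.

Definition padic_vec (p : nat) (p_pr : prime p) (t : nat)
    (alpha : {ffun 'I_t -> int}) : 'I_t -> padic_int p_pr :=
  fun j => (alpha j)%:~R.

Definition int_voltage := {t : nat & {ffun 'I_t -> int}}.

Section Counting.
Variables (R : realType) (l : nat) (l_pr : prime l) (delta : R).
Local Open Scope classical_set_scope.

Definition A_le (x : R) : set int_voltage :=
  [set w : int_voltage | let t := tag w in let alpha : {ffun 'I_t -> int} := tagged w in
    [/\ (2 <= t)%N, t%:R <= x `^ delta,
        (\max_(i < t) `|alpha i|)%N%:R <= x
      & exists i : 'I_t, ~~ (l%:Z %| alpha i)%Z]].

Definition T_le (mu : nat) (lambda : int) (x : R) : set int_voltage :=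
  [set w | A_le x w /\ mu_inv (padic_vec l_pr (tagged w)) = mu
                    /\ lambda_inv (padic_vec l_pr (tagged w)) = lambda].

End Counting.

(* Meaningful for finite sets only: fset_set sends infinite sets to fset0. *)
Definition ncard (T : choiceType) (A : set T) : nat := #|` fset_set A|%fset.

(* Main.v *)
(* The T^0 and T^1 coefficients of f vanish and its T^2 coefficient is
   - sum_j alpha_j^2, so mu = 0 and lambda = 1 exactly when l does not divide
   sum_j alpha_j^2: if it does not, then f = T^2 * unit, and reduction mod l
   shows that any Weierstrass factorization of f has mu = 0 and deg g = 2.
   Put N = floor x, B = 2 N + 1 and K = floor (x^delta). There are at most B^t
   vectors of length t, hence at most B^K / (B - 1) of length t < K, and since
   B tends to infinity only t = K matters. For t = K, the values of
   sum_j alpha_j^2 mod l equidistribute as K grows, uniformly in N >= l: summing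
   over one coordinate is a random walk step on Z/l which takes each of the
   steps 0 and 1 with probability at least c = 1/(2 l), so l - 1 steps reach
   every residue with probability at least c^(l-1) and contract the sup norm of
   mean zero functions. The vectors divisible by l are exponentially rare. *)
From HB Require Import structures.
Require Import Defs.
From mathcomp Require Import all_boot all_order all_algebra.
From mathcomp Require Import boolp classical_sets reals topology normedtype.
From mathcomp Require Import finmap functions cardinality sequences exp ring.
Import Order.TTheory GRing.Theory Num.Theory.
Import numFieldNormedType.Exports.

Set Implicit Arguments.
Unset Strict Implicit.

Local Open Scope classical_set_scope.
Local Open Scope ring_scope.

(** * Reduction of p-adic integers modulo p, and invertibility *)

Section Residue.
Variables (p : nat) (p_pr : prime p).
Local Notation Zp := (padic_int p_pr).

Definition padic_resF (x : Zp) : 'F_p := (x 1%N)%:~R.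

Lemma Fp_intr_congr (m n : int) : (m = n %[mod p])%Z -> m%:~R = n%:~R :> 'F_p.
Proof.
move/eqP; rewrite eqz_mod_dvd (dvdz_pcharf (pchar_Fp p_pr)) rmorphB subr_eq0.
by move/eqP.
Qed.

Lemma padic_resF_is_zmod : zmod_morphism padic_resF.
Proof.
move=> x y; rewrite /padic_resF -rmorphB; apply: Fp_intr_congr.
have := padic_resD x (- y) 1; rewrite expn1 => ->; apply: modzD_congr => //.
by have := padic_resN y 1; rewrite expn1.
Qed.

Lemma padic_resF_is_monoid : monoid_morphism padic_resF.
Proof.
split=> [|x y]; rewrite /padic_resF.
  rewrite -[1]/(1%:~R); apply: Fp_intr_congr.
  by have := padic_res_nat p_pr 1 1; rewrite expn1.
rewrite -rmorphM; apply: Fp_intr_congr.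
by have := padic_resM x y 1; rewrite expn1.
Qed.

HB.instance Definition _ :=
  GRing.isZmodMorphism.Build Zp 'F_p padic_resF padic_resF_is_zmod.
HB.instance Definition _ :=
  GRing.isMonoidMorphism.Build Zp 'F_p padic_resF padic_resF_is_monoid.

(** For n > 0 all [x n] agree with [x 1] modulo p, so they are prime to p. Bezout gives an inverse
    modulo each p^n, and uniqueness of inverses makes these compatible. *)
Lemma padic_resF_invertible (x : Zp) : padic_resF x != 0 -> exists y, x * y = 1.
Proof.
move=> x_neq0.
have cop n : coprimez (x n) (p ^ n)%N.
  case: n => [|n]; first by rewrite coprimezE expn0 coprimen1.
  rewrite coprimezE absz_nat coprimeXr // coprime_sym prime_coprime //.
  have e : (x n.+1 = x 1%N %[mod p])%Z.
    by have := padic_res_le x 1 n; rewrite expn1 add1n.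
  apply: contra x_neq0 => pxn.
  by rewrite /padic_resF -(Fp_intr_congr e) -(dvdz_pcharf (pchar_Fp p_pr)) dvdzE.
have /choice[v hv] n : exists y : int, (x n * y = 1 %[mod (p ^ n)%N])%Z.
  have [u [w]] := Bezoutz (x n) (p ^ n)%N.
  rewrite (eqP (cop n)) => e; exists u; apply/eqP; rewrite eqz_mod_dvd -e.
  by rewrite mulrC opprD addrA subrr sub0r -mulNr dvdz_mull.
have hu n : (v n.+1 = v n %[mod (p ^ n)%N])%Z.
  have h1 : (x n * v n.+1 = 1 %[mod (p ^ n)%N])%Z.
    rewrite -(modzM_congr (padic_modS x n) (erefl (v n.+1 %% _)%Z)).
    by rewrite -modz_expS hv modz_expS.
  rewrite -[v n.+1]mul1r -(modzM_congr (hv n) (erefl (v n.+1 %% _)%Z)).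
  rewrite mulrAC -(modzM_congr (esym h1) (erefl (v n %% _)%Z)).
  by rewrite mul1r.
exists (padic_of p_pr hu); apply: padic_eqP => n.
rewrite padic_resM (modzM_congr (erefl (x n %% _)%Z) (padic_ofE p_pr hu n)) hv.
by rewrite (padic_res_nat p_pr 1 n).
Qed.

End Residue.

(** * Units of the power series ring *)

Section SeriesInverse.
Variable R : comNzRingType.
Implicit Types a b : Defs.pseries R.

Lemma pseriesMn a b n : (a * b) n = \sum_(i < n.+1) a i * b (n - i)%N.
Proof. by []. Qed.

Lemma pseriesDn a b n : (a + b) n = a n + b n.
Proof. by []. Qed.

Lemma pseriesNn a n : (- a) n = - a n.
Proof. by []. Qed.

Lemma pseries1n n : (1 : Defs.pseries R) n = (n == 0%N)%:R.
Proof. by []. Qed.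

Lemma pseries_of_polyn (g : {poly R}) n : pseries_of_poly g n = g`_n.
Proof. by []. Qed.

Lemma pseries_mulrnn a m n : (a *+ m) n = a n *+ m.
Proof. by elim: m => [|m IHm]; rewrite ?mulr0n // !mulrS pseriesDn IHm. Qed.

Lemma pseries_sumn (I : finType) (F : I -> Defs.pseries R) n :
  (\sum_i F i) n = \sum_i F i n.
Proof. by apply: (big_morph (fun s : Defs.pseries R => s n)). Qed.

Lemma pseriesX_coef0 b n k : b 0%N = 0 -> (n < k)%N -> (b ^+ k) n = 0.
Proof.
move=> b0; elim: k n => // k IHk n nk.
rewrite exprS pseriesMn big_ord_recl b0 mul0r add0r big1 // => i _.
rewrite IHk ?mulr0 //= /bump /= add1n.
apply: leq_trans (nk : (n <= k)%N).
by rewrite ltn_subrL (leq_ltn_trans _ (ltn_ord i)).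
Qed.

(* The geometric series: the coefficient of T^n in sum_k b^k only involves the
   k <= n. *)
Lemma pseries_unit1B b : b 0%N = 0 -> pseries_unit (1 - b).
Proof.
move=> b0; pose v := PSeries (fun n => (\sum_(k < n.+1) b ^+ k) n).
have vE m i : (i <= m)%N -> v i = (\sum_(k < m.+1) b ^+ k) i.
  move=> im; rewrite /v /= !pseries_sumn.
  rewrite (big_ord_widen m.+1 (fun k => (b ^+ k) i)) //.
  rewrite big_mkcond /=; apply: eq_bigr => k _; case: ltnP => // ik.
  by rewrite pseriesX_coef0.
exists v; apply: pseriesP => n; rewrite pseriesMn.
under eq_bigr => i _ do rewrite (vE n) ?leq_subr //.
rewrite -pseriesMn -opprB mulNr -subrX1 opprB pseriesDn pseriesNn.
by rewrite pseriesX_coef0 // subr0.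
Qed.

(** Multiplying by the constant [c] makes the constant term 1, which is the case of
    [pseries_unit1B]. *)
Lemma pseries_unitP a c : a 0%N * c = 1 -> pseries_unit a.
Proof.
move=> ac; pose C := PSeries (fun n => if n == 0%N then c else 0).
have [|w hw] := @pseries_unit1B (1 - a * C).
  rewrite pseriesDn pseriesNn pseriesMn big_ord_recl big_ord0 addr0.
  by rewrite subn0 pseries1n [C 0%N]/= ac subrr.
by exists (C * w); rewrite mulrA -[a * C](subKr 1).
Qed.

End SeriesInverse.

(** * Low coefficients of f and the invariants mu and lambda *)

Section Invariants.
Variables (p : nat) (p_pr : prime p).
Local Notation Zp := (padic_int p_pr).
Local Notation res := (@padic_resF p p_pr).

Lemma padic_binom0 (b : Zp) : padic_binom b 0 = 1.
Proof. by rewrite -[LHS]mul1r -[1]/(0`!%:R) padic_binomP big_ord0. Qed.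

Lemma padic_binom1 (b : Zp) : padic_binom b 1 = b.
Proof.
by rewrite -[LHS]mul1r -[1]/(1`!%:R) padic_binomP big_ord1 subr0.
Qed.

(** Twice the left side is b(b - 1) + b(b + 1), and multiplication by 2 is injective on Z_p. *)
Lemma padic_binom2D (b : Zp) : padic_binom b 2 + padic_binom (- b) 2 = b ^+ 2.
Proof.
apply: (@padic_torsion_free p p_pr 2) => //; rewrite /= mulrDr -[2%:R]/(2`!%:R).
rewrite !padic_binomP !big_ord_recr !big_ord0 /= !mul1r !subr0 mulNr -mulrBr.
by rewrite opprB opprK addrA subrK expr2 mulrDr mulrC mulrDl mul1r.
Qed.

Lemma charseries0 t (alpha : 'I_t -> Zp) : charseries alpha 0%N = 0.
Proof.
rewrite /charseries pseries_sumn big1 // => j _.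
rewrite !pseriesDn !pseriesNn !pseries1n /= !padic_binom0.
by rewrite addrK subrr.
Qed.

Lemma charseries1 t (alpha : 'I_t -> Zp) : charseries alpha 1%N = 0.
Proof.
rewrite /charseries pseries_sumn big1 // => j _.
rewrite !pseriesDn !pseriesNn !pseries1n /= !padic_binom1.
by rewrite opprK !add0r addNr.
Qed.

Lemma charseries2 t (alpha : 'I_t -> Zp) :
  charseries alpha 2%N = - \sum_j alpha j ^+ 2.
Proof.
rewrite /charseries pseries_sumn -sumrN; apply: eq_bigr => j _.
rewrite !pseriesDn !pseriesNn !pseries1n /= !add0r.
by rewrite -opprD padic_binom2D.
Qed.

(** Modulo p, g becomes T^deg g, so multiplying by g only shifts coefficients. When mu = 0, deg g is
    then the index of the first coefficient of f that is nonzero modulo p. *)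
Lemma padic_resF_distinguished (g : {poly Zp}) i : distinguished g ->
  (i <= (size g).-1)%N -> res g`_i = (i == (size g).-1)%:R.
Proof.
move=> [g_monic g_div]; case: eqVneq => [-> _|i_neq].
  by have /monicP := g_monic; rewrite /lead_coef => ->; rewrite rmorph1.
rewrite leq_eqVlt (negPf i_neq) /= => /g_div[c ->].
by rewrite rmorphM rmorph_nat pchar_Fp_0 ?mul0r.
Qed.

Lemma weierstrass_coef0 f g u i : weierstrass f (0%N, g, u) ->
  (i < (size g).-1)%N -> res (f i) = 0.
Proof.
move=> [g_dist _ ->] i_lt; rewrite expr0 mul1r pseriesMn rmorph_sum big1 // => k _.
have kg : (k < (size g).-1)%N by rewrite (leq_ltn_trans _ i_lt) // -ltnS.
rewrite rmorphM pseries_of_polyn /= padic_resF_distinguished ?(ltnW kg) //.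
by rewrite (ltn_eqF kg) mul0r.
Qed.

Lemma weierstrass_coef_neq0 f g u : weierstrass f (0%N, g, u) ->
  res (f (size g).-1) != 0.
Proof.
move=> [g_dist [v uv] ->]; rewrite expr0 mul1r pseriesMn rmorph_sum big_ord_recr.
rewrite big1 => [|k _]; last first.
  have kg := ltn_ord k.
  rewrite rmorphM pseries_of_polyn /= padic_resF_distinguished ?(ltnW kg) //.
  by rewrite (ltn_eqF kg) mul0r.
rewrite /= add0r rmorphM /= padic_resF_distinguished // eqxx mul1r subnn.
(* The constant term of [u] has inverse [v 0], hence is nonzero modulo p. *)
have /(congr1 (fun s : Defs.pseries Zp => res (s 0%N))) := uv.
rewrite pseriesMn big_ord1 subn0 pseries1n eqxx rmorphM rmorph1.
by move=> /=; apply: contra_eq_neq => /= ->; rewrite mul0r eq_sym oner_eq0.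
Qed.

Lemma weierstrass_coef_mu f mu g u i : weierstrass f (mu.+1, g, u) ->
  res (f i) = 0.
Proof.
move=> [_ _ ->]; rewrite exprS -!mulrA mulr_natl.
by rewrite pseries_mulrnn rmorphMn -mulr_natr pchar_Fp_0 ?mulr0.
Qed.

(** f is T^2 times its shift, and the shift is a unit because its constant term [f 2] is nonzero
    modulo p. *)
Lemma weierstrass_X2 (f : Defs.pseries Zp) :
  f 0%N = 0 -> f 1%N = 0 -> res (f 2%N) != 0 ->
  exists u, weierstrass f (0%N, 'X^2, u).
Proof.
move=> f0 f1 /padic_resF_invertible[c fc].
exists (PSeries (fun n => f n.+2)); split; last first.
- rewrite expr0 mul1r; apply: pseriesP => n; rewrite pseriesMn.
  case: n => [|[|n]].
  + by rewrite big_ord1 /= coefXn mul0r.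
  + by rewrite !big_ord_recl big_ord0 /= !coefXn !mul0r !addr0.
  rewrite (bigD1 (inord 2)) //= inordK // coefXn mul1r subSS subSS subn0.
  rewrite big1 ?addr0 // => k; rewrite -val_eqE /= inordK // => /negPf k2.
  by rewrite coefXn k2 mul0r.
- exact: (@pseries_unitP _ _ c).
split; first exact: monicXn.
rewrite size_polyXn => i i2; exists 0; rewrite coefXn mulr0.
by case: i i2 => [|[|]].
Qed.

(** This holds for any factorization that [xget] may pick: mu > 0 would make f vanish modulo p, and
    for mu = 0 the degree of g is the first index where f is nonzero modulo p, which is at least
    2. *)
Lemma mu0_lambda1P t (alpha : 'I_t -> Zp) :
  (mu_inv alpha = 0%N /\ lambda_inv alpha = 1) <->
  res (\sum_j alpha j ^+ 2) != 0.
Proof.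
rewrite -oppr_eq0 -rmorphN -charseries2.
rewrite /mu_inv /lambda_inv /weierstrass_fact; set f := charseries alpha.
case: xgetP => [[[mu g] u] _ /= fw|no_w]; last first.
  (* Without a factorization the default triple gives lambda = -1, while a nonzero residue would
     supply a factorization. *)
  split=> [[_]|/(weierstrass_X2 (charseries0 _) (charseries1 _))[u fw]].
    by rewrite size_poly0.
  by have := no_w _ fw.
split=> [[mu0 g2]|f2].
  have g3 : (size g).-1 = 2%N.
    by case: ((size g).-1) g2 => [|[|[|k]]] //.
  by move: fw; rewrite mu0 => /weierstrass_coef_neq0; rewrite g3.
case: mu fw => [|mu] fw; last by rewrite (weierstrass_coef_mu _ fw) eqxx in f2.
split=> //; suff -> : (size g).-1 = 2%N by [].
apply/eqP; rewrite eqn_leq; apply/andP; split.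
  by rewrite leqNgt; apply: contra f2 => /(weierstrass_coef0 fw)/eqP.
have := weierstrass_coef_neq0 fw.
by case: ((size g).-1) => [|[|k]] //; rewrite ?charseries0 ?charseries1 rmorph0 eqxx.
Qed.

Lemma mu0_lambda1_intP t (alpha : {ffun 'I_t -> int}) :
  (mu_inv (padic_vec p_pr alpha) = 0%N /\ lambda_inv (padic_vec p_pr alpha) = 1)
  <-> \sum_j ((alpha j)%:~R : 'F_p) ^+ 2 != 0.
Proof.
rewrite mu0_lambda1P rmorph_sum.
by under eq_bigr => j _ do rewrite rmorphXn rmorph_int.
Qed.

End Invariants.

(** * Mixing of a random walk on F_p *)

Section Mixing.
Variables (R : realFieldType) (p : nat) (p_pr : prime p) (I : finType).
Variables (v : I -> 'F_p) (c : R).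
Local Notation B := (#|I|%:R : R).
Hypothesis c_ge0 : 0 <= c.
Hypothesis v0 : c * B <= #|[pred a | v a == 0]|%:R.
Hypothesis v1 : c * B <= #|[pred a | v a == 1]|%:R.
Implicit Types (m : R) (h : 'F_p -> R) (s r : 'F_p).

(** One step of the walk with increments [v a], left unnormalized: constants get multiplied by
    [B]. *)
Definition transfer h s : R := \sum_a h (s - v a).

Lemma transfer_ge h s r : (forall x, 0 <= h x) ->
  c * B <= #|[pred a | v a == r]|%:R -> c * B * h (s - r) <= transfer h s.
Proof.
move=> h_ge0 vr; rewrite /transfer (bigID (fun a => v a == r)) /=.
apply: ler_wpDr; first by apply: sumr_ge0.
rewrite (eq_bigr (fun=> h (s - r))) => [|a /eqP-> //].
by rewrite sumr_const -[leRHS]mulr_natl ler_wpM2r.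
Qed.

Lemma transfer_iter_ge0 h t s : (forall x, 0 <= h x) -> 0 <= iter t transfer h s.
Proof.
by move=> h_ge0; elim: t s => [//|t IHt] s; rewrite iterS sumr_ge0.
Qed.

(** Among the t steps, i move by 1 and t - i stay in place; each such step is realized by at least
    [c * B] indices. *)
Lemma transfer_iter_ge h i t s : (forall x, 0 <= h x) -> (i <= t)%N ->
  (c * B) ^+ t * h (s - i%:R) <= iter t transfer h s.
Proof.
move=> h_ge0; have cB_ge0 : 0 <= c * B by rewrite mulr_ge0.
elim: t i s => [|t IHt] i s; first by rewrite leqn0 => /eqP->; rewrite mul1r subr0.
have step r j : c * B <= #|[pred a | v a == r]|%:R -> (j <= t)%N ->
    (c * B) ^+ t.+1 * h (s - r - j%:R) <= iter t.+1 transfer h s.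
  move=> vr jt; have := transfer_ge s (fun x => transfer_iter_ge0 t x h_ge0) vr.
  by apply: le_trans; rewrite exprS -mulrA ler_wpM2l ?IHt.
rewrite leq_eqVlt => /orP[/eqP->|it].
  by have := step 1 t v1 (leqnn t); rewrite -addrA -opprD -mulrS.
by have := step 0 i v0 it; rewrite subr0.
Qed.

(** The difference s - r has a representative in [0, p - 1], so p - 1 steps by 0 or 1 connect any
    two residues. *)
Lemma transfer_iter_ge_full h s r : (forall x, 0 <= h x) ->
  (c * B) ^+ p.-1 * h r <= iter p.-1 transfer h s.
Proof.
move=> h_ge0; have := @transfer_iter_ge h (s - r)%R p.-1 s h_ge0.
rewrite natr_Zp subKr; apply.
have Ep : (Zp_trunc (pdiv p)).+2 = p by exact: Fp_cast.
have := leq_trans (ltn_ord (s - r)) (eq_leq Ep).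
by rewrite -{1}[p in (_ < p)%N](prednK (prime_gt0 p_pr)) ltnS.
Qed.

Lemma transfer_iterDc h m t s :
  iter t transfer (fun x => m + h x) s = B ^+ t * m + iter t transfer h s.
Proof.
elim: t s => [|t IHt] s; first by rewrite mul1r.
rewrite !iterS /transfer; under eq_bigr => a _ do rewrite IHt.
by rewrite big_split /= sumr_const exprS -mulrA mulr_natl.
Qed.

Lemma transfer_iterN h t s :
  iter t transfer (fun x => - h x) s = - iter t transfer h s.
Proof.
elim: t s => [//|t IHt] s; rewrite !iterS /transfer -sumrN.
by under eq_bigr => a _ do rewrite IHt.
Qed.

Lemma sum_transfer_iter h t :
  \sum_s h s = 0 -> \sum_s iter t transfer h s = 0.
Proof.
move=> h0; elim: t => // t IHt; rewrite iterS /transfer exchange_big /= big1 // => a _.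
by rewrite -[RHS]IHt [RHS](reindex_inj (addIr (- v a))).
Qed.

Lemma transfer_iter_le h m t s :
  (forall x, `|h x| <= m) -> `|iter t transfer h s| <= B ^+ t * m.
Proof.
move=> hm; elim: t s => [|t IHt] s; first by rewrite mul1r.
rewrite iterS /transfer exprS -mulrA mulr_natl -sumr_const.
by apply: le_trans (ler_norm_sum _ _ _) _; apply: ler_sum.
Qed.

(* Apply the minorization to m + h >= 0 and average over the target residue. *)
Lemma transfer_contraction_ge h m s :
  (forall x, - m <= h x) -> \sum_x h x = 0 ->
  - ((1 - c ^+ p.-1) * B ^+ p.-1 * m) <= iter p.-1 transfer h s.
Proof.
move=> hm h0; rewrite mulrBl mul1r -exprMn mulrBl opprB lerBlDr addrC -transfer_iterDc.
have p_gt0 : 0 < p%:R :> R by rewrite ltr0n prime_gt0.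
set X := iter _ _ _ _; have : \sum_r (c * B) ^+ p.-1 * (m + h r) <= \sum_(r : 'F_p) X.
  apply: ler_sum => r _; apply: (@transfer_iter_ge_full (fun x => m + h x)) => x.
  by rewrite -lerBlDl sub0r.
rewrite -mulr_sumr big_split /= h0 addr0 !sumr_const card_Fp //.
by rewrite -[leRHS]mulr_natl -[m *+ p]mulr_natl mulrCA ler_pM2l.
Qed.

Lemma transfer_contraction h m s :
  (forall x, `|h x| <= m) -> \sum_x h x = 0 ->
  `|iter p.-1 transfer h s| <= (1 - c ^+ p.-1) * B ^+ p.-1 * m.
Proof.
move=> hm h0; rewrite ler_norml; apply/andP; split.
  by apply: transfer_contraction_ge => // x; have := hm x; rewrite ler_norml => /andP[].
rewrite -lerN2 -transfer_iterN; apply: transfer_contraction_ge => [x|].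
  by rewrite lerN2; have := hm x; rewrite ler_norml => /andP[].
by rewrite sumrN h0 oppr0.
Qed.

(** Each full block of p - 1 steps contracts; the [t %% p.-1] remaining steps cost at most a factor
    [B] each. *)
Lemma transfer_iter_decay h m t s :
  (forall x, `|h x| <= m) -> \sum_x h x = 0 ->
  `|iter t transfer h s| <= (1 - c ^+ p.-1) ^+ (t %/ p.-1) * B ^+ t * m.
Proof.
move=> hm h0; rewrite {1 3}(divn_eq t p.-1) addnC exprD iterD.
rewrite mulrCA -!mulrA; apply: transfer_iter_le => {s} s.
elim: (t %/ p.-1)%N s => [|q IHq] s; first by rewrite !mul1r.
rewrite mulSn iterD exprS exprD -[_ ^+ _ * _ * m]mulrA mulrACA.
by apply: transfer_contraction => //; exact: sum_transfer_iter.
Qed.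

Lemma transfer_iterE h t s :
  iter t transfer h s = \sum_(a : {ffun 'I_t -> I}) h (s - \sum_i v (a i)).
Proof.
elim: t s => [|t IHt] s.
  have a0 : 'I_0 -> I by case.
  rewrite (big_pred1 (finfun a0)) ?big_ord0 ?subr0 // => a.
  by apply/esym/eqP/ffunP; case.
rewrite iterS /transfer; under eq_bigr => b _ do rewrite IHt.
rewrite pair_big /=.
(* Prepending a coordinate and splitting it off are inverse bijections between I x I^t and
   I^(t+1). *)
pose cons (q : I * {ffun 'I_t -> I}) : {ffun 'I_t.+1 -> I} :=
  [ffun i => oapp q.2 q.1 (unlift ord0 i)].
pose uncons (a : {ffun 'I_t.+1 -> I}) :=
  (a ord0, [ffun j => a (lift ord0 j)] : {ffun 'I_t -> I}).
rewrite [RHS](reindex cons) /=.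
  apply: eq_bigr => q _; rewrite big_ord_recl /cons ffunE unlift_none /=.
  rewrite opprD addrA; congr (h (_ - _)); apply: eq_bigr => i _.
  by rewrite ffunE liftK.
exists uncons => [q _|a _].
  rewrite /uncons /cons ffunE unlift_none /= [RHS]surjective_pairing; congr pair.
  by apply/ffunP => j; rewrite !ffunE liftK.
by apply/ffunP => i; rewrite ffunE; case: unliftP => [j|] -> /=; rewrite ?ffunE.
Qed.

Lemma card_sum_eq0 t :
  #|[pred a : {ffun 'I_t -> I} | \sum_i v (a i) == 0]|%:R
    = iter t transfer (fun x => (x == 0)%:R) 0.
Proof.
rewrite transfer_iterE -sum1_card natr_sum big_mkcond /=.
by apply: eq_bigr => a _; rewrite inE sub0r oppr_eq0; case: eqP.
Qed.

(** The indicator of 0 is 1/p plus a mean zero function [h] of sup norm at most 1. The constant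
    contributes exactly B^t / p, and [h] decays. *)
Lemma equidistribution t :
  `|#|[pred a : {ffun 'I_t -> I} | \sum_i v (a i) == 0]|%:R - B ^+ t / p%:R|
    <= (1 - c ^+ p.-1) ^+ (t %/ p.-1) * B ^+ t.
Proof.
have p_ge1 : 1 <= p%:R :> R by rewrite ler1n prime_gt0.
have p_gt0 : 0 < p%:R :> R by apply: lt_le_trans p_ge1.
pose h (x : 'F_p) : R := (x == 0)%:R - p%:R^-1.
have -> : #|[pred a : {ffun 'I_t -> I} | \sum_i v (a i) == 0]|%:R - B ^+ t / p%:R
    = iter t transfer h 0.
  rewrite card_sum_eq0 [X in iter _ _ X](_ : _ = fun x => p%:R^-1 + h x); last first.
    by apply/funext => x; rewrite /h addrC subrK.
  by rewrite transfer_iterDc addrC addKr.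
rewrite -[leRHS]mulr1; apply: transfer_iter_decay => [x|].
  have pV_ge0 : 0 <= p%:R^-1 :> R by rewrite invr_ge0 ltW.
  have pV_le1 : p%:R^-1 <= 1 :> R by rewrite invf_le1.
  rewrite /h; case: eqP => _ /=; last by rewrite sub0r normrN ger0_norm.
  by rewrite ger0_norm ?subr_ge0 // lerBlDr lerDl.
rewrite big_split /= sumr_const card_Fp // (bigD1 0) //= big1 => [|x /negPf-> //].
by rewrite addr0 mulNrn -[_^-1 *+ _]mulr_natl divff ?subrr // gt_eqF.
Qed.

End Mixing.

(** * Residue classes in an interval and integral vectors in a box *)

Lemma card_Fp_residue (p B : nat) (p_pr : prime p) (r : 'F_p) :
  (B %/ p <= #|[pred a : 'I_B | (a%:R : 'F_p) == r]|)%N.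
Proof.
have Ep : (Zp_trunc (pdiv p)).+2 = p by exact: Fp_cast.
have r_lt : (r < p)%N := leq_trans (ltn_ord r) (eq_leq Ep).
(* The interval [0, B) contains [B %/ p] full blocks of length p, and block j contains
   [j * p + r]. *)
have lt_B (j : 'I_(B %/ p)) : (j * p + r < B)%N.
  apply: leq_trans (leq_divM B p); apply: leq_trans (_ : j.+1 * p <= _)%N.
    by rewrite mulSn addnC ltn_add2r.
  by rewrite leq_mul2r ltn_ord orbT.
pose f j := Ordinal (lt_B j).
have f_inj : injective f.
  move=> i j /(congr1 val) /= /addIn /eqP.
  by rewrite eqn_pmul2r ?prime_gt0 // => /eqP /val_inj.
rewrite -[leqLHS]card_ord -(fintype.card_image f_inj).
apply: subset_leq_card; apply/fintype.subsetP.
move=> _ /fintype.imageP[j _ ->]; rewrite inE /= natrD natrM pchar_Fp_0 // mulr0 add0r.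
by rewrite natr_Zp.
Qed.

Lemma ncard_image (I : finType) (T : choiceType) (e : I -> T) (P : pred I) :
  injective e -> ncard [set e i | i in [set` P]] = #|P|.
Proof.
move=> e_inj; rewrite /ncard.
have -> : [set e i | i in [set` P]] = [set` [fset x in [seq e i | i in P]]%fset].
  apply/seteqP; split=> [_ [i Pi <-]|x]; rewrite /= inE.
    by apply/fintype.imageP; exists i.
  by move=> /fintype.imageP[i Pi ->]; exists i.
by rewrite set_fsetK card_fseq undup_id ?size_image // map_inj_uniq ?enum_uniq.
Qed.

(** Shifting by N identifies the box [-N, N]^t with a finite type, so that vectors can be counted by
    [#|_|]. *)
Definition centered (N t : nat) (a : {ffun 'I_t -> 'I_N.*2.+1}) : {ffun 'I_t -> int} :=
  [ffun i => (a i)%:Z - N%:Z].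

Lemma centered_inj N t : injective (@centered N t).
Proof.
move=> a b /ffunP ab; apply/ffunP => i; apply/val_inj.
by have := ab i; rewrite !ffunE => /addIr[].
Qed.

Lemma centeredP N t (alpha : {ffun 'I_t -> int}) :
  (forall i, `|alpha i| <= N)%N -> exists a, alpha = @centered N t a.
Proof.
(* The shifted entries lie in [0, 2N], so [inord] never takes its default value. *)
move=> alphaN; exists [ffun i => inord `|alpha i + N%:Z|].
apply/ffunP => i; rewrite !ffunE.
have := alphaN i; rewrite -lez_nat abszE ler_norml => /andP[lo hi].
have ge0 : 0 <= alpha i + N%:Z by rewrite -lerBlDr sub0r.
rewrite inordK; first by rewrite gez0_abs // addrK.
by rewrite ltnS -lez_nat gez0_abs // -addnn PoszD lerD2r.
Qed.

Lemma abs_centered N t a i : (`|@centered N t a i| <= N)%N.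
Proof.
rewrite ffunE -lez_nat abszE ler_norml; apply/andP; split.
  by rewrite -[leLHS]add0r lerD2r.
by rewrite lerBlDr -PoszD addnn lez_nat -ltnS ltn_ord.
Qed.

(** The set is the injective image of a finite dependent sum over the lengths t, so [ncard] splits
    along t. *)
Lemma ncard_voltages (N K : nat) (Q : forall t, pred {ffun 'I_t -> int}) :
  ncard [set w : int_voltage | [/\ (2 <= tag w <= K)%N,
           (forall i, `|tagged w i| <= N)%N & Q (tag w) (tagged w)]]
    = (\sum_(t < K.+1 | 2 <= t) #|[pred a | Q t (@centered N t a)]|)%N.
Proof.
under eq_bigr => t _ do rewrite -sum1_card.
rewrite sig_big_dep sum1_card /=.
pose I := {t : 'I_K.+1 & {ffun 'I_t -> 'I_N.*2.+1}}.
pose e (w : I) : int_voltage :=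
  Tagged (fun t => {ffun 'I_t -> int}) (centered (tagged w)).
have e_inj : injective e.
  move=> [t a] [t' a'] ee.
  have tt' : t = t' by apply/val_inj; exact: (congr1 tag ee).
  case: _ / tt' a' ee => a' ee; congr existT; apply: (@centered_inj N t).
  exact: existT_inj2 ee.
rewrite -(ncard_image _ e_inj); congr ncard; apply/seteqP; split.
  move=> [t alpha] /= [/andP[t2 tK] /centeredP[a ->] Qa].
  exists (Tagged (fun t : 'I_K.+1 => {ffun 'I_t -> 'I_N.*2.+1})
    (i := Ordinal (tK : (t < K.+1)%N)) a) => //.
  by rewrite unfold_in /= t2 inE.
move=> _ [[t a] + <-]; rewrite /= unfold_in /= inE => /andP[t2 Qa]; split=> //=.
  by rewrite t2 -ltnS ltn_ord.
exact: abs_centered.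
Qed.

(** * Counts of admissible and generic voltages *)

Section Counts.
Variables (R : realType) (l : nat) (l_pr : prime l).

Definition admissible t : pred {ffun 'I_t -> int} :=
  fun alpha => [exists i, ~~ (l %| alpha i)%Z].

(** The criterion of [mu0_lambda1_intP] for mu = 0 and lambda = 1. *)
Definition generic t : pred {ffun 'I_t -> int} :=
  fun alpha => \sum_i ((alpha i)%:~R : 'F_l) ^+ 2 != 0.

Lemma generic_admissible t (alpha : {ffun 'I_t -> int}) :
  generic alpha -> admissible alpha.
Proof.
rewrite /generic /admissible /=; apply: contraNT => /existsPn alpha0.
rewrite big1 // => i _; have := alpha0 i; rewrite negbK.
by rewrite (dvdz_pcharf (pchar_Fp l_pr)) => /eqP->; rewrite expr0n.
Qed.

(** Lengths and maxima are natural numbers, so the real bounds may be truncated; this is the form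
    that [ncard_voltages] counts. *)
Lemma A_leE delta (x : R) : 0 <= x ->
  A_le l delta x =
    [set w : int_voltage | [/\ (2 <= tag w <= Num.truncn (x `^ delta))%N,
       (forall i, `|tagged w i| <= Num.truncn x)%N & admissible (tagged w)]].
Proof.
move=> x_ge0; apply/seteqP; split=> -[t alpha]; rewrite /A_le /=.
  rewrite -!truncn_ge_nat ?powR_ge0 // => -[t2 tK /bigmax_leqP alphaN alpha_adm].
  by split; [rewrite t2 | move=> i; exact: alphaN | apply/existsP].
move=> [/andP[t2 tK] alphaN /existsP alpha_adm].
rewrite -!truncn_ge_nat ?powR_ge0 //; split=> //.
by apply/bigmax_leqP => i _.
Qed.

Lemma T_leE delta (x : R) : 0 <= x ->
  T_le l_pr delta 0%N 1 x =
    [set w : int_voltage | [/\ (2 <= tag w <= Num.truncn (x `^ delta))%N,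
       (forall i, `|tagged w i| <= Num.truncn x)%N & generic (tagged w)]].
Proof.
move=> x_ge0; apply/seteqP; split=> w; rewrite /T_le A_leE //=.
  by move=> [[tK alphaN _] /mu0_lambda1_intP].
move=> [tK alphaN alpha_gen]; split; last by apply/mu0_lambda1_intP.
by split=> //; apply: generic_admissible.
Qed.

Variable N : nat.
Hypothesis lN : (l <= N)%N.
Local Notation B := (N.*2.+1).
Local Notation c := ((2 * l)%:R^-1 : R).

(** With q = B %/ l >= 1 one has B < (q + 1) l <= 2 l q, and each class has at least q members;
    hence the 2 in [c]. *)
Lemma residue_density (P : pred 'I_B) (r : 'F_l) :
  (forall a : 'I_B, (a%:R : 'F_l) = r -> P a) -> c * B%:R <= #|P|%:R.
Proof.
move=> rP; have l_gt0 := prime_gt0 l_pr.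
rewrite mulrC ler_pdivrMr ?ltr0n ?muln_gt0 // -natrM ler_nat.
have B_l : (1 <= B %/ l)%N.
  by rewrite divn_gt0 // leqW // -addnn (leq_trans lN) ?leq_addr.
have : (B <= B %/ l * (2 * l))%N.
  apply: leq_trans (ltnW (ltn_ceil B l_gt0)) _.
  set q := (B %/ l)%N in B_l *.
  by rewrite mulnA leq_mul2r muln2 -addnn -addn1 leq_add2l B_l orbT.
move=> /leq_trans; apply; rewrite leq_mul2r; apply/orP; right.
apply: leq_trans (card_Fp_residue _ l_pr r) _; apply: subset_leq_card.
by apply/fintype.subsetP => a; rewrite inE => /eqP /rP.
Qed.

Lemma density_ge0 : 0 <= c.
Proof. by rewrite invr_ge0. Qed.

Definition sqr_residue (a : 'I_B) : 'F_l := (a%:Z - N%:Z)%:~R ^+ 2.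

Lemma card_not_generic t :
  `|#|[pred a | ~~ generic (@centered N t a)]|%:R - B%:R ^+ t / l%:R|
    <= (1 - c ^+ l.-1) ^+ (t %/ l.-1) * B%:R ^+ t.
Proof.
(* The class of r + N is sent to r^2; since 0 and 1 are squares, both required steps of the walk are
   available. *)
have density r : c * #|'I_B|%:R <= #|[pred a | sqr_residue a == r ^+ 2]|%:R.
  rewrite card_ord; apply: (@residue_density _ (r + N%:R)) => a /= ar.
  by rewrite /sqr_residue rmorphB /= -!pmulrn ar addrK.
have d0 := density 0; have d1 := density 1; rewrite expr0n in d0; rewrite expr1n in d1.
have := equidistribution l_pr density_ge0 d0 d1 t; rewrite card_ord; apply: le_trans.
rewrite le_eqVlt; apply/orP; left; apply/eqP; congr (`|_%:R - _|).
apply: eq_card => a; rewrite !inE negbK; congr (_ == _).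
by apply: eq_bigr => i _; rewrite ffunE.
Qed.

(** Every coordinate must lie in the class of N, which misses the class of 1 + N and so leaves at
    most a share 1 - c. *)
Lemma card_not_admissible t :
  #|[pred a | ~~ admissible (@centered N t a)]|%:R <= (1 - c) ^+ t * B%:R ^+ t.
Proof.
pose D : pred 'I_B := [pred a : 'I_B | (l %| a%:Z - N%:Z)%Z].
rewrite (_ : #|_| = #|D| ^ t)%N; last first.
  have <- : (#|D| ^ #|'I_t| = #|D| ^ t)%N by rewrite card_ord.
  rewrite -card_ffun_on; apply: eq_card => a.
  rewrite !inE negb_exists; apply/forallP/ffun_onP => H i; have := H i;
    by rewrite negbK ffunE inE.
rewrite natrX -exprMn lerXn2r ?nnegrE //.
  have l2 : (0 < 2 * l)%N by rewrite muln_gt0 (prime_gt0 l_pr).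
  by rewrite mulr_ge0 // subr_ge0 invf_le1 ?ler1n ?ltr0n.
have DB : #|D|%:R + #|[predC D]|%:R = B%:R :> R by rewrite -natrD cardC card_ord.
rewrite mulrBl mul1r lerBrDl -[leRHS]DB addrC lerD2l.
apply: (@residue_density _ (1 + N%:R)) => a /= ar.
rewrite inE /= (dvdz_pcharf (pchar_Fp l_pr)) rmorphB /= -!pmulrn ar addrK.
exact: oner_neq0.
Qed.

(** The length K contributes the main term; the shorter lengths have at most (B^K - 1) / (B - 1)
    vectors, and B - 1 = 2N. *)
Lemma ncard_dominant K (Q : forall t, pred {ffun 'I_t -> int}) : (2 <= K)%N ->
  `|(ncard [set w : int_voltage | [/\ (2 <= tag w <= K)%N,
           (forall i, `|tagged w i| <= N)%N & Q (tag w) (tagged w)]])%:R / B%:R ^+ K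
     - (1 - #|[pred a | ~~ Q K (@centered N K a)]|%:R / B%:R ^+ K)|
    <= (N.*2)%:R^-1 :> R.
Proof.
move=> K2; have N_gt0 : (0 < N)%N := leq_trans (prime_gt0 l_pr) lN.
have BK_gt0 : 0 < B%:R ^+ K :> R by rewrite exprn_gt0 ?ltr0n.
pose u t := #|[pred a | Q t (@centered N t a)]|.
have uK : (u K + #|[pred a | ~~ Q K (@centered N K a)]| = B ^ K)%N.
  have := cardC [pred a | Q K (@centered N K a)].
  by rewrite card_ffun !card_ord.
have -> : 1 - #|[pred a | ~~ Q K (@centered N K a)]|%:R / B%:R ^+ K
    = (u K)%:R / B%:R ^+ K :> R.
  rewrite -{1}(divff (lt0r_neq0 BK_gt0)) -mulrBl -natrX -uK natrD addrK.
  by [].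
rewrite ncard_voltages big_mkcond big_ord_recr /= K2 -/(u K) natrD mulrDl addrK.
rewrite ger0_norm ?divr_ge0 ?(ltW BK_gt0) //.
rewrite ler_pdivrMr // mulrC ler_pdivlMr ?ltr0n ?double_gt0 //.
rewrite -natrX -natrM ler_nat mulnC.
(* Geometric sum: B^K - 1 is 2N times the sum of B^t over t < K. *)
apply: leq_trans (leq_pred _); rewrite predn_exp leq_mul2l; apply/orP; right.
apply: leq_sum => t _; case: ifP => // _; apply: leq_trans (max_card _) _.
by rewrite card_ffun !card_ord.
Qed.

End Counts.

(** * Limits at infinity *)

Section Limit.
Variable R : realType.

Lemma cvg_norm_le (f g : R -> R) (a : R) :
  (\forall x \near +oo, `|f x - a| <= g x) -> g x @[x --> +oo] --> 0 ->
  f x @[x --> +oo] --> a.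
Proof.
move=> fg g0; apply/cvgrPdist_le => e e_gt0.
have ge := cvgr_le _ g0 _ e_gt0.
near=> x; rewrite distrC; apply: (@le_trans _ _ (g x)).
  by near: x.
by near: x; exact: ge.
Unshelve. all: by end_near.
Qed.

Lemma truncn_cvg : Num.truncn (x : R) @[x --> +oo] --> \oo.
Proof.
apply/cvgnyPge => n; near=> x.
have nx : n%:R <= x by near: x; apply: nbhs_pinfty_ge; rewrite num_real.
by rewrite truncn_ge_nat // (le_trans _ nx).
Unshelve. all: by end_near.
Qed.

Lemma powR_cvg (delta : R) : 0 < delta -> x `^ delta @[x --> +oo] --> +oo.
Proof.
move=> delta_gt0; apply/cvgryPge => A; near=> x.
apply: le_trans (ler_norm A) _.
rewrite -[leLHS]powRr1 // -(mulVf (lt0r_neq0 delta_gt0)) powRrM.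
have Ax : `|A| `^ delta^-1 <= x.
  by near: x; apply: nbhs_pinfty_ge; rewrite num_real.
by apply: ge0_ler_powR;
  rewrite ?nnegrE ?powR_ge0 ?(ltW delta_gt0) ?(le_trans _ Ax) ?powR_ge0.
Unshelve. all: by end_near.
Qed.

Lemma expr_divn_cvg (q : R) (k : nat) : (0 < k)%N -> `|q| < 1 ->
  q ^+ (n %/ k) @[n --> \oo] --> 0.
Proof.
move=> k_gt0 q1.
apply: (@cvg_comp _ _ _ (fun n => n %/ k)%N (fun n => q ^+ n)).
  exact: cvg_divnr.
exact: cvg_expr.
Qed.

End Limit.

Unset Implicit Arguments.

Theorem theorem4p21 (R : realType) (l : nat) (l_pr : prime l) (l_odd : odd l)
    (delta : R) (delta_gt0 : 0 < delta) (delta_lt1 : delta < 1) :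
  (ncard (T_le l_pr delta 0%N 1 x))%:R / (ncard (A_le l delta x))%:R
    @[x --> +oo] --> 1 - (l%:R : R)^-1.
Proof.
pose c : R := (2 * l)%:R^-1.
pose N (x : R) := Num.truncn x; pose K (x : R) := Num.truncn (x `^ delta).
(* The common normalization: the number of all vectors of length K in the box. *)
pose b (x : R) : R := ((N x).*2.+1)%:R ^+ K x.
have l_gt1 := prime_gt1 l_pr.
have N_cvg : N x @[x --> +oo] --> \oo := @truncn_cvg R.
have K_cvg : K x @[x --> +oo] --> \oo.
  exact: cvg_comp (powR_cvg delta_gt0) (@truncn_cvg R).
have N_near n : \forall x \near +oo, (n <= N x)%N by move/cvgnyPge: N_cvg; exact.
have K_near n : \forall x \near +oo, (n <= K x)%N by move/cvgnyPge: K_cvg; exact.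
have c_gt0 : 0 < c by rewrite invr_gt0 ltr0n muln_gt0 (prime_gt0 l_pr).
have c_lt1 : c < 1.
  by rewrite invf_lt1 ?ltr1n ?ltr0n ?muln_gt0 ?(prime_gt0 l_pr) //
    (leq_trans l_gt1) ?leq_pmull.
have tail_cvg : ((N x).*2)%:R^-1 @[x --> +oo] --> (0 : R).
  apply/gtr0_cvgV0.
    near=> x; rewrite ltr0n double_gt0; near: x.
    exact: (N_near 1%N).
  apply/cvgrnyP/cvgnyPge => A; near=> x.
  rewrite -addnn (leq_trans _ (leq_addr _ _)) //; near: x.
  exact: (N_near A).
have near_l : \forall x \near +oo, (0 <= x /\ (l <= N x)%N) /\ (2 <= K x)%N.
  near=> x; split; first split.
  - by near: x; apply: nbhs_pinfty_ge; rewrite num_real.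
  - by near: x; exact: (N_near l).
  - by near: x; exact: (K_near 2%N).
have T_cvg : (ncard (T_le l_pr delta 0%N 1 x))%:R / b x @[x --> +oo]
    --> 1 - (l%:R : R)^-1.
  (* The first term bounds the share of lengths below K, the second the deviation from 1/l of the
     non-generic share at length K. *)
  pose g x := (N x).*2%:R^-1 + (1 - c ^+ l.-1) ^+ (K x %/ l.-1).
  apply: (@cvg_norm_le _ _ g).
    near=> x.
    have [[x_ge0 lN] K2] : (0 <= x /\ (l <= N x)%N) /\ (2 <= K x)%N by near: x.
    have b_gt0 : 0 < b x by rewrite exprn_gt0 ?ltr0n.
    have nZ := card_not_generic R l_pr lN (K x).
    have := ncard_dominant R l_pr lN (generic l) K2; rewrite T_leE // -/(b x).
    move: nZ; rewrite -/(b x) -/c; set Z := #|_|%:R; set X := _ / b x => nZ nX.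
    have -> : X - (1 - l%:R^-1) = (X - (1 - Z / b x)) - (Z / b x - l%:R^-1).
      by rewrite !opprB !addrA; ring.
    apply: le_trans (ler_normB _ _) _; apply: lerD => //.
    rewrite (_ : Z / b x - l%:R^-1 = (Z - b x / l%:R) / b x); last first.
      by rewrite mulrBl mulrAC divff ?mul1r ?gt_eqF.
    by rewrite normf_div (gtr0_norm b_gt0) ler_pdivrMr.
  rewrite -[0]addr0; apply: cvgD => //.
  apply: (@cvg_comp _ _ _ K (fun n => (1 - c ^+ l.-1) ^+ (n %/ l.-1)) _ _ _ K_cvg).
  apply: expr_divn_cvg; first by rewrite -ltnS prednK ?prime_gt0.
  rewrite ger0_norm ?subr_ge0 ?exprn_ile1 ?(ltW c_gt0) ?(ltW c_lt1) //.
  by rewrite gtrBl exprn_gt0.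
have A_cvg : (ncard (A_le l delta x))%:R / b x @[x --> +oo] --> (1 : R).
  (* Here the second term bounds the share of vectors of length K divisible by l. *)
  pose g x := (N x).*2%:R^-1 + (1 - c) ^+ K x.
  apply: (@cvg_norm_le _ _ g).
    near=> x.
    have [[x_ge0 lN] K2] : (0 <= x /\ (l <= N x)%N) /\ (2 <= K x)%N by near: x.
    have b_gt0 : 0 < b x by rewrite exprn_gt0 ?ltr0n.
    have nZ := card_not_admissible R l_pr lN (K x).
    have := ncard_dominant R l_pr lN (admissible l) K2; rewrite A_leE // -/(b x).
    move: nZ; rewrite -/(b x) -/c; set Z := #|_|%:R; set X := _ / b x => nZ nX.
    have -> : X - 1 = (X - (1 - Z / b x)) - Z / b x by ring.
    apply: le_trans (ler_normB _ _) _; apply: lerD => //.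
    by rewrite ger0_norm ?divr_ge0 ?(ltW b_gt0) // ler_pdivrMr.
  rewrite -[0]addr0; apply: cvgD => //.
  apply: (@cvg_comp _ _ _ K (fun n => (1 - c) ^+ n) _ _ _ K_cvg); apply: cvg_expr.
  by rewrite ger0_norm ?subr_ge0 ?(ltW c_lt1) // gtrBl.
(* As [b x] is nonzero, the ratio is the quotient of the two normalized counts. *)
rewrite [X in X @ _ --> _](_ : _ = fun x =>
  ((ncard (T_le l_pr delta 0%N 1 x))%:R / b x)
    / ((ncard (A_le l delta x))%:R / b x));
  last first.
  apply/funext => x; rewrite invf_div mulrA divfK // expf_neq0 //.
  by rewrite pnatr_eq0.
rewrite -[1 - _]divr1; apply: cvgM => //; apply: cvgV => //; exact: oner_neq0.
Unshelve. all: by end_near.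
Qed.
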